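(* Let $k$ be a field, let $G$ be a group and let $\mathcal{C}$ be a $G$-$k$-category. Let $M_G(\mathcal{C})$ be the resolving category of $\mathcal{C}$. There is an equivalence of $G$-$k$-categories $L: M_G(\mathcal{C}) \to \mathcal{C}$.
   Context: A $k$-category $\mathcal{C}$ is a small category enriched over $k$-vector spaces: it has a set of objects $\mathcal{C}_0$, the morphisms from $x$ to $y$ form a $k$-vector space denoted ${}_y\mathcal{C}_x$, and composition is $k$-bilinear. A $G$-$k$-category is a $k$-category $\mathcal{C}$ with an action of $G$ by $k$-isomorphisms of $\mathcal{C}$, i.e. a group homomorphism from $G$ to the group of $k$-functors $\mathcal{C}\to\mathcal{C}$ which are isomorphisms. Thus $G$ acts on $\mathcal{C}_0$, each $s\in G$ gives $k$-linear maps ${}_y\mathcal{C}_x\to {}_{sy}\mathcal{C}_{sx}$, $f\mapsto sf$, compatible with composition, with $t(sf)=(ts)f$, and $s({}_x1_x)={}_{sx}1_{sx}$. An equivalence of $G$-$k$-categories is a $k$-functor commuting (strictly) with the actions of $G$ on objects and morphisms and which is an equivalence of $k$-categories. The resolving category $M_G(\mathcal{C})$ is the following $G$-$k$-category. Its set of objects is $G\times \mathcal{C}_0$; ${}_{(t,y)}(M_G(\mathcal{C}))_{(s,x)} = {}_y\mathcal{C}_x$; composition is given by the composition of $\mathcal{C}$. The action of $r\in G$ is $r(s,x)=(rs,rx)$ on objects, and it sends $f\in {}_{(t,y)}(M_G(\mathcal{C}))_{(s,x)}={}_y\mathcal{C}_x$ to $rf\in {}_{ry}\mathcal{C}_{rx}={}_{(rt,ry)}(M_G(\mathcal{C}))_{(rs,rx)}$.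 *)

(* Defs.v *)
From HB Require Import structures.
From mathcomp Require Import all_boot all_algebra.

Set Implicit Arguments.
Unset Strict Implicit.
Unset Printing Implicit Defensive.

Import GRing.Theory.
Local Open Scope ring_scope.

(* [mor x y] is the space of morphisms from x to y (written _yC_x in the
   literature), and [kcomp g f] is "g after f". *)
Record kCategory (k : fieldType) := KCategory {
  obj :> Type;
  mor : obj -> obj -> lmodType k;
  idm : forall x, mor x x;
  kcomp : forall x y z, mor y z -> mor x y -> mor x z;
  comp_linear_r : forall x y z (g : mor y z), linear (@kcomp x y z g);
  comp_linear_l : forall x y z (f : mor x y),
    linear (fun g : mor y z => kcomp g f);
  compA : forall x y z t (h : mor z t) (g : mor y z) (f : mor x y),
    kcomp h (kcomp g f) = kcomp (kcomp h g) f;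
  comp1m : forall x y (f : mor x y), kcomp (idm y) f = f;
  compm1 : forall x y (f : mor x y), kcomp f (idm x) = f
}.
Arguments idm {k} C x : rename.

Record kFunctor (k : fieldType) (C D : kCategory k) := KFunctor {
  fobj :> C -> D;
  fmor : forall x y, {linear mor x y -> mor (fobj x) (fobj y)};
  fmor_id : forall x, fmor x x (idm C x) = idm D (fobj x);
  fmor_comp : forall x y z (g : mor y z) (f : mor x y),
    fmor x z (kcomp g f) = kcomp (fmor y z g) (fmor x y f)
}.
Arguments fmor {k C D} F {x y} : rename.

Section Functors.
Variable k : fieldType.
Implicit Types C D : kCategory k.

(* Equality of morphisms whose endpoints are equal but perhaps not
   syntactically the same: same source, same target and same morphism. By
   uniqueness of identity proofs (objects form a set), [same_mor f g] is just
   [f = g] when f and g already have the same declared endpoints. *)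
Inductive same_mor C (x y : C) (f : mor x y) :
    forall x' y' : C, mor x' y' -> Prop :=
  SameMor : @same_mor C x y f x y f.

(* Strict equality of functors (not natural isomorphism); the equality of
   objects is part of [same_mor] but is stated separately for readability. *)
Definition same_functor C D (F H : kFunctor C D) : Prop :=
  (forall x : C, F x = H x) /\
  (forall (x y : C) (f : mor x y), same_mor (fmor F f) (fmor H f)).

Definition id_functor C : kFunctor C C :=
  @KFunctor k C C (fun x => x) (fun x y => idfun)
    (fun x => erefl) (fun x y z g f => erefl).

Section CompFunctor.
Variables (C D E : kCategory k) (H : kFunctor D E) (F : kFunctor C D).

Let cmor (x y : C) : {linear mor x y -> mor (H (F x)) (H (F y))} :=
  fmor H \o fmor F.

Fact comp_functor_id (x : C) : cmor x x (idm C x) = idm E (H (F x)).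
Proof. by rewrite /= !fmor_id. Qed.

Fact comp_functor_comp (x y z : C) (g : mor y z) (f : mor x y) :
  cmor x z (kcomp g f) = kcomp (cmor y z g) (cmor x y f).
Proof. by rewrite /= !fmor_comp. Qed.

Definition comp_functor : kFunctor C E :=
  @KFunctor k C E (fun x => H (F x)) cmor comp_functor_id comp_functor_comp.

End CompFunctor.

Definition is_iso C (x y : C) (f : mor x y) : Prop :=
  exists g : mor y x, kcomp g f = idm C x /\ kcomp f g = idm C y.

Definition nat_iso C D (F H : kFunctor C D) : Prop :=
  exists eta : forall x : C, mor (F x) (H x),
    (forall (x y : C) (f : mor x y),
        kcomp (eta y) (fmor F f) = kcomp (fmor H f) (eta x)) /\
    (forall x : C, is_iso (eta x)).

Definition is_equivalence C D (F : kFunctor C D) : Prop :=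
  exists H : kFunctor D C,
    nat_iso (comp_functor H F) (id_functor C) /\
    nat_iso (comp_functor F H) (id_functor D).

End Functors.

(* The two laws say that [act] is a monoid morphism to the k-endofunctors of
   the category under composition; since G is a group, each [act s] is then
   an isomorphism with inverse [act s^-1]. *)
Record GkCategory (k : fieldType) (G : groupType) := GKCategory {
  base :> kCategory k;
  act : G -> kFunctor base base;
  act_one : same_functor (act 1%g) (id_functor base);
  act_mul : forall t s : G,
    same_functor (act (t * s)%g) (comp_functor (act t) (act s))
}.

Definition G_equivariant (k : fieldType) (G : groupType)
    (C D : GkCategory k G) (F : kFunctor C D) : Prop :=
  forall s : G,
    same_functor (comp_functor F (act C s)) (comp_functor (act D s) F).

Definition is_G_equivalence (k : fieldType) (G : groupType)
    (C D : GkCategory k G) (F : kFunctor C D) : Prop :=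
  G_equivariant F /\ is_equivalence F.

Section Resolving.
Variables (k : fieldType) (G : groupType) (C : GkCategory k G).

Definition resolving_kcat : kCategory k :=
  @KCategory k (G * C)%type (fun a b => mor a.2 b.2)
    (fun a => idm C a.2) (fun a b c g f => kcomp g f)
    (fun a b c => @comp_linear_r k C a.2 b.2 c.2)
    (fun a b c => @comp_linear_l k C a.2 b.2 c.2)
    (fun a b c d => @compA k C a.2 b.2 c.2 d.2)
    (fun a b => @comp1m k C a.2 b.2)
    (fun a b => @compm1 k C a.2 b.2).

Definition resolving_act (r : G) : kFunctor resolving_kcat resolving_kcat :=
  @KFunctor k resolving_kcat resolving_kcat
    (fun a => ((r * a.1)%g, act C r a.2))
    (fun a b => @fmor k C C (act C r) a.2 b.2)
    (fun a => fmor_id (act C r) a.2)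
    (fun a b c => @fmor_comp k C C (act C r) a.2 b.2 c.2).

Lemma same_mor_resolving (s s' t t' : G) (x y x' y' : C)
    (f : mor x y) (f' : mor x' y') :
  s = s' -> t = t' -> same_mor f f' ->
  @same_mor k resolving_kcat (s, x) (t, y) f (s', x') (t', y') f'.
Proof. by move=> -> -> []. Qed.

Lemma resolving_act_one :
  same_functor (resolving_act 1%g) (id_functor resolving_kcat).
Proof.
have [e1 e2] := act_one C; split=> [[s x]|[s x] [t y] f] /=.
  by rewrite mul1g e1.
by apply: same_mor_resolving; rewrite ?mul1g //; apply: e2.
Qed.

Lemma resolving_act_mul (t s : G) :
  same_functor (resolving_act (t * s)%g)
    (comp_functor (resolving_act t) (resolving_act s)).
Proof.
have [e1 e2] := act_mul C t s; split=> [[r x]|[r x] [q y] f] /=.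
  by rewrite mulgA e1.
by apply: same_mor_resolving; rewrite ?mulgA //; apply: e2.
Qed.

Definition resolving : GkCategory k G :=
  @GKCategory k G resolving_kcat resolving_act
    resolving_act_one resolving_act_mul.

End Resolving.

(* Main.v *)
Require Import Defs.
From mathcomp Require Import all_boot all_algebra.

(** The functor [L] forgets the group coordinate: it sends [(s, x)] to [x] and
    is the identity on each morphism space, since the morphisms of the
    resolving category from [(s, x)] to [(t, y)] are by definition those of the
    base category from [x] to [y]. The group acts on second coordinates and on
    morphisms exactly as it does on the base category, so [L] commutes strictly
    with the actions.

    A quasi-inverse is the section [x |-> (1, x)]. It is a k-functor, in general
    not an equivariant one, since [r] moves [(1, x)] to [(r, rx)]. Applying the
    section and then [L] gives the identity functor; applying [L] and then the
    section sends [(s, x)] to [(1, x)], and these two objects are isomorphic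
    through the identity of [x]. *)

Section ResolvingProjection.
Variables (k : fieldType) (G : groupType) (C : GkCategory k G).

Definition resolving_proj : kFunctor (resolving C) C :=
  @KFunctor k (resolving C) C (fun a => a.2) (fun a b => idfun)
    (fun a => erefl) (fun a b c g f => erefl).

Definition resolving_section : kFunctor C (resolving C) :=
  @KFunctor k C (resolving C) (fun x => (1%g, x)) (fun x y => idfun)
    (fun x => erefl) (fun x y z g f => erefl).

Lemma resolving_proj_equivariant : G_equivariant resolving_proj.
Proof. by move=> s; split. Qed.

(** Changing the group coordinate of an object does not change its isomorphism
    class: the identity of [x] in the base category is an isomorphism from
    [(s, x)] to [(1, x)], with inverse the same identity. *)
Lemma resolving_section_proj :
  nat_iso (comp_functor resolving_section resolving_proj)
    (id_functor (resolving C)).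
Proof.
exists (fun a : resolving C => idm C a.2); split=> [a b f | a].
  exact: etrans (comp1m f) (esym (compm1 f)).
by exists (idm C a.2); split; exact: (comp1m (idm C a.2)).
Qed.

Lemma resolving_proj_section :
  nat_iso (comp_functor resolving_proj resolving_section) (id_functor C).
Proof.
exists (idm C); split=> [x y f | x]; first by rewrite comp1m compm1.
by exists (idm C x); rewrite comp1m.
Qed.

Lemma resolving_proj_equivalence : is_equivalence resolving_proj.
Proof.
exists resolving_section; split.
  exact: resolving_section_proj.
exact: resolving_proj_section.
Qed.

End ResolvingProjection.

Theorem theorem2p12 (k : fieldType) (G : groupType) (C : GkCategory k G) :
  exists L : kFunctor (resolving C) C, is_G_equivalence L.
Proof.
exists (resolving_proj k G C); split.
  exact: resolving_proj_equivariant.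
exact: resolving_proj_equivalence.
Qed.
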